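(* Let $m\ge1$ and $\mu=(1,1,\ldots,1)$ ($m$ ones). Then $\mathcal R_m$ is a set of canonical matrices for $\mu$-similarity of matrices of order $m$: every matrix $A\in M_m(K)$ is $\mu$-similar to exactly one matrix belonging to $\mathcal R_m$.
   Context: $K$ is an algebraically closed field of characteristic zero. For $\mu=(1,\ldots,1)$: matrices $C,\tilde C\in GL_m(K)$ are $\mu$-mutual if $C$ is lower triangular, $\tilde C$ is upper triangular, and $C$, $\tilde C$ have the same diagonal entries ($c_{ii}=\tilde c_{ii}$ for all $i$). Matrices $A,B\in M_m(K)$ are $\mu$-similar if there exist $\mu$-mutual $C,\tilde C$ with $CA=B\tilde C$. $\mathcal U_m$ is the set of matrices $A\in M_m(K)$ such that every row and every column of $A$ contains at most one non-zero entry. For $A\in\mathcal U_m$, a sequence $\langle a_{i_1j_1},a_{i_2j_2},\ldots,a_{i_lj_l}\rangle$ of non-zero entries of $A$ is a chain if $l=1$, or $i_{t+1}=j_t$ and $i_1<i_{t+1}$ for $t=1,\ldots,l-1$. Its leading element is $a_{i_1j_1}$. A chain is maximal if it cannot be embedded in another chain of larger length; only maximal chains are considered. A (maximal) chain is closed if $i_1=j_l$, and open otherwise. $\mathcal R_m$ is the set of matrices $A\in\mathcal U_m$ such that all non-zero entries of $A$, except possibly the leading elements of closed (maximal) chains of $A$, are equal to $1$. *)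

(* Defs.v *)
From mathcomp Require Import all_boot all_order all_algebra.

Set Implicit Arguments.
Unset Strict Implicit.
Unset Printing Implicit Defensive.

Import GRing.Theory.
Local Open Scope ring_scope.

Section Similarity.

Variables (K : fieldType) (m : nat).
Implicit Types A B C D : 'M[K]_m.

(* [is_trig_mx] is lower triangularity. *)
Definition mu_mutual C D : Prop :=
  [/\ C \in unitmx, D \in unitmx, is_trig_mx C, is_trig_mx D^T
    & forall i : 'I_m, C i i = D i i].

Definition mu_similar A B : Prop :=
  exists C D : 'M[K]_m, mu_mutual C D /\ C *m A = B *m D.

Definition in_U A : Prop :=
  (forall i : 'I_m, (#|[set j : 'I_m | A i j != 0%R]| <= 1)%N) /\
  (forall j : 'I_m, (#|[set i : 'I_m | A i j != 0%R]| <= 1)%N).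

(* The entry a_ij is represented by its position (i, j), so that entries with
   equal values at different positions are kept apart. *)
Definition chain A (s : seq ('I_m * 'I_m)) : bool :=
  if s is p :: s' then
    [&& all (fun q : 'I_m * 'I_m => A q.1 q.2 != 0) s,
        path (fun p1 p2 : 'I_m * 'I_m => p2.1 == p1.2) p s'
      & all (fun q : 'I_m * 'I_m => (p.1 < q.1)%N) s']
  else false.

(* Within U_m a position has at most one possible successor, so embedding one
   chain in another as a contiguous block is the same as embedding it as a
   subsequence. *)
Definition maximal_chain A (s : seq ('I_m * 'I_m)) : Prop :=
  chain A s /\
  forall t, chain A t -> infix s t -> (size t <= size s)%N.

Definition closed_chain (s : seq ('I_m * 'I_m)) : bool :=
  if s is p :: s' then p.1 == (last p s').2 else false.

Definition leads_closed_chain A (p : 'I_m * 'I_m) : Prop :=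
  exists s, maximal_chain A (p :: s) /\ closed_chain (p :: s).

Definition in_R A : Prop :=
  in_U A /\
  forall i j : 'I_m, A i j != 0 -> ~ leads_closed_chain A (i, j) -> A i j = 1.

End Similarity.

(* Main.v *)
(* Unitriangular elimination, clearing only below and to the right of pivots,
   brings A to a matrix of U_m, seen as a weighted graph whose components are
   paths and cycles. Conjugating by a diagonal matrix t multiplies the weight of
   i -> j by t_i / t_j, so all weights can be made 1 except for one arrow per
   cycle, chosen to start at the least vertex. Conversely, if C B = B' D with B
   and B' in U_m and C, D mutual, comparing entries gives
   c_ii b_ij = b'_ij c_jj: the supports coincide, c is constant along the arrows
   of weight 1 in each cycle, and hence B = B'. *)
Require Import Defs.
From mathcomp Require Import all_boot all_order all_algebra.

Set Implicit Arguments.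
Unset Strict Implicit.
Unset Printing Implicit Defensive.

Import GRing.Theory.
Local Open Scope ring_scope.

Section MuSimilarity.

Context {K : fieldType} {m : nat}.
Implicit Types A B C D M W X Y : 'M[K]_m.

(** * Triangular matrices and mutual pairs *)

Lemma trig_unitmx_diag_neq0 X (i : 'I_m) :
  is_trig_mx X -> X \in unitmx -> X i i != 0.
Proof.
move=> tX; rewrite unitmxE unitfE det_trig // => /prodf_neq0; exact.
Qed.

Lemma mulmx_trig_diag X Y (i : 'I_m) :
  is_trig_mx X -> is_trig_mx Y -> (X *m Y) i i = X i i * Y i i.
Proof.
move=> /is_trig_mxP tX /is_trig_mxP tY; rewrite mxE (bigD1 i) //= big1 ?addr0 //.
move=> k; rewrite neq_ltn => /orP[ki|ik]; first by rewrite tY ?mulr0.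
by rewrite tX ?mul0r.
Qed.

Lemma mulmx_trig X Y : is_trig_mx X -> is_trig_mx Y -> is_trig_mx (X *m Y).
Proof.
move=> /is_trig_mxP tX /is_trig_mxP tY; apply/is_trig_mxP => i j ij.
rewrite mxE big1 // => k _; have [ki|ik] := leqP k i.
  by rewrite tY ?mulr0 // (leq_ltn_trans ki).
by rewrite tX ?mul0r.
Qed.

(** Induction on the row [i]: in entry [(i, j)] of [X *m invmx X = 1%:M] only the term
    [X i i * invmx X i j] can survive, and [X i i] is non-zero. *)
Lemma invmx_trig X : X \in unitmx -> is_trig_mx X -> is_trig_mx (invmx X).
Proof.
move=> uX tX; apply/is_trig_mxP => i j.
have [n le_in] := ubnP (i : nat); elim: n i le_in => // n IH i le_in ij.
have /matrixP/(_ i j) := mulmxV uX.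
rewrite !mxE -val_eqE /= ltn_eqF // (bigD1 i) //= big1 ?addr0.
  move/eqP; rewrite mulf_eq0 (negPf (trig_unitmx_diag_neq0 i tX uX)).
  by move/eqP.
move=> k; rewrite neq_ltn => /orP[ki|ik]; last first.
  by move/is_trig_mxP: tX => ->; rewrite ?mul0r.
by rewrite IH ?mulr0 ?(ltn_trans ki ij) // (leq_trans ki).
Qed.

Lemma invmx_trig_diag X (i : 'I_m) :
  X \in unitmx -> is_trig_mx X -> (invmx X) i i = (X i i)^-1.
Proof.
move=> uX tX; apply: (mulfI (trig_unitmx_diag_neq0 i tX uX)).
rewrite -mulmx_trig_diag ?invmx_trig // mulmxV // mxE eqxx mulfV //.
exact: trig_unitmx_diag_neq0.
Qed.

Lemma mu_mutual_mul C D C' D' :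
  mu_mutual C D -> mu_mutual C' D' -> mu_mutual (C *m C') (D *m D').
Proof.
move=> [uC uD tC tD CD] [uC' uD' tC' tD' CD']; split.
- by rewrite unitmx_mul uC.
- by rewrite unitmx_mul uD.
- exact: mulmx_trig.
- by rewrite trmx_mul mulmx_trig.
move=> i; have -> : (D *m D') i i = (D'^T *m D^T) i i by rewrite -trmx_mul [RHS]mxE.
by rewrite !mulmx_trig_diag // ![_^T i i]mxE CD CD' mulrC.
Qed.

Lemma mu_mutual_inv C D : mu_mutual C D -> mu_mutual (invmx C) (invmx D).
Proof.
move=> [uC uD tC tD CD]; split; rewrite ?unitmx_inv ?invmx_trig //.
  by rewrite trmx_inv invmx_trig // unitmx_tr.
move=> i; rewrite invmx_trig_diag // CD.
have -> : (invmx D) i i = (invmx D^T) i i by rewrite -trmx_inv mxE.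
by rewrite invmx_trig_diag ?unitmx_tr // mxE.
Qed.

Lemma mu_similar_trans A B M : mu_similar A B -> mu_similar B M -> mu_similar A M.
Proof.
move=> [C [D [CD eAB]]] [C' [D' [CD' eBM]]].
exists (C' *m C), (D' *m D); split; first exact: mu_mutual_mul.
by rewrite -mulmxA eAB mulmxA eBM mulmxA.
Qed.

Lemma mu_similar_sym A B : mu_similar A B -> mu_similar B A.
Proof.
move=> [C [D [CD eAB]]]; exists (invmx C), (invmx D).
split; first exact: mu_mutual_inv.
have [uC uD _ _ _] := CD; apply: (can_inj (mulKmx uC)).
by rewrite mulKVmx // mulmxA eAB mulmxK.
Qed.

Lemma mu_mutual_unitriangular C D :
    (forall i j : 'I_m, (i < j)%N -> C i j = 0) ->
    (forall i j : 'I_m, (j < i)%N -> D i j = 0) ->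
    (forall i, C i i = 1) -> (forall i, D i i = 1) ->
  mu_mutual C D.
Proof.
move=> tC tD dC dD.
have {}tC : is_trig_mx C by apply/is_trig_mxP.
have {}tD : is_trig_mx D^T by apply/is_trig_mxP => i j ij; rewrite mxE tD.
split=> //; last by move=> i; rewrite dC dD.
  by rewrite unitmxE det_trig // big1 ?unitr1.
by rewrite -unitmx_tr unitmxE det_trig // big1 ?unitr1 // => i _; rewrite mxE.
Qed.

Lemma mu_similar_refl A : mu_similar A A.
Proof.
exists 1%:M, 1%:M; rewrite mul1mx mulmx1; split=> //.
apply: mu_mutual_unitriangular => [i j ij|i j ji|i|i]; rewrite mxE ?eqxx //.
  by rewrite -val_eqE /= ltn_eqF.
by rewrite -val_eqE /= gtn_eqF.
Qed.

(** * Elimination to a matrix of U_m *)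

Lemma in_UP W :
  in_U W <->
  (forall i j j' : 'I_m, W i j != 0 -> W i j' != 0 -> j = j') /\
  (forall i i' j : 'I_m, W i j != 0 -> W i' j != 0 -> i = i').
Proof.
split=> -[r c]; split.
- move=> i j j' wj wj'; have /card_le1_eqP h := r i.
  by apply: h; rewrite inE.
- move=> i i' j wi wi'; have /card_le1_eqP h := c j.
  by apply: h; rewrite inE.
- move=> i; apply/card_le1_eqP => j j'; rewrite !inE => *; exact: (r i).
- move=> j; apply/card_le1_eqP => i i'; rewrite !inE => *; exact: (c _ _ j).
Qed.

(* A pivot at the first non-zero entry of its row only needs to clear entries
   below and to the right of it. *)
Lemma mu_similar_pivot M (k j : 'I_m) :
    M k j != 0 -> (forall l : 'I_m, (l < j)%N -> M k l = 0) ->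
    (forall i : 'I_m, (i < k)%N -> M i j = 0) ->
  mu_similar M (\matrix_(i, l) if (i == k) && (l == j) then M k j
                               else M i l - M i j / M k j * M k l).
Proof.
move=> kj0 left0 above0; set M' := \matrix_(_, _) _.
(* The left factor subtracts multiples of row [k] from the other rows; the right factor rebuilds row
   [k] of [M] from the pivot, the only non-zero entry in that row of [M']. Triangularity comes from
   [above0] and [left0]. *)
pose u : 'cV[K]_m := \col_i (if i == k then 0 else M i j / M k j).
pose w : 'rV[K]_m := \row_l (M k l / M k j - (l == j)%:R).
exists (1%:M - u *m delta_mx 0 k), (1%:M + delta_mx j 0 *m w); split.
  apply: mu_mutual_unitriangular => [i l il|i l li|i|i];
    rewrite !mxE big_ord1 !mxE ?eqxx //= -?val_eqE /=.
  - rewrite (ltn_eqF il) sub0r; case: eqP => [|_]; first by rewrite mul0r oppr0.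
    case: eqP => [lk|_]; last by rewrite mulr0 oppr0.
    by rewrite above0 ?mul0r ?oppr0 -?lk.
  - rewrite (gtn_eqF li) add0r andbT; case: eqP => [ij|_]; last by rewrite mul0r.
    by rewrite -ij (ltn_eqF li) left0 -?ij // mul0r subr0 mulr0.
  - by case: eqP => _; rewrite ?mul0r ?mulr0 subr0.
  - case: eqP => [ij|_]; last by rewrite mul0r addr0.
    by rewrite (val_inj ij) divff // subrr mulr0 addr0.
rewrite mulmxBl mul1mx mulmxDr mulmx1 -mulmxA -rowE mulmxA -colE.
apply/matrixP => i l; rewrite !mxE !big_ord1 !mxE eqxx andbT.
case: (eqVneq i k) => [->|ik] /=; case: (eqVneq l j) => [->|lj] //=.
- by rewrite mul0r subr0 divff // subrr mulr0 addr0.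
- by rewrite mul0r !subr0 divff // mul1r subrr add0r mulrCA divff // mulr1.
- by rewrite divff // subrr mulr0 addr0.
- by rewrite divfK // subrr mul0r addr0.
Qed.

Lemma mu_similar_in_U A : exists2 W, mu_similar A W & in_U W.
Proof.
(* Invariant: a non-zero entry in the first [k] rows is alone in its row and in its whole column. *)
suff /(_ m (leqnn m))[W AW h] : forall k, (k <= m)%N -> exists2 W, mu_similar A W &
    forall i j : 'I_m, (i < k)%N -> W i j != 0 ->
      (forall j' : 'I_m, W i j' != 0 -> j' = j) /\
      (forall i' : 'I_m, W i' j != 0 -> i' = i).
  exists W => //; apply/in_UP; split=> [i j j' w1 w2|i i' j w1 w2].
    by have [/(_ j w1)] := h i j' (ltn_ord i) w2.
  by have [_ /(_ i w1)] := h i' j (ltn_ord i') w2.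
elim=> [_|k IH km]; first by exists A => //; exact: mu_similar_refl.
have [M AM hM] := IH (ltnW km); pose K0 := Ordinal km.
have ltS (i : 'I_m) : (i < k.+1)%N -> i = K0 \/ (i < k)%N.
  by rewrite ltnS leq_eqVlt => /orP[/eqP ik|]; [left; exact: val_inj|right].
have [j0 Mj0|row0] := pickP [pred j | M K0 j != 0]; last first.
  exists M => // i j /ltS[->|/hM]; last exact.
  by have /= -> := row0 j.
have /(arg_minnP (@nat_of_ord m))[j kj0 jmin] := Mj0; rewrite /= in kj0 jmin.
have left0 (l : 'I_m) : (l < j)%N -> M K0 l = 0.
  by apply: contraTeq => /jmin; rewrite -leqNgt.
have above0 (i : 'I_m) : (i < K0)%N -> M i j = 0.
  move=> ik; apply: contraTeq kj0 => Mij; have [_ cj] := hM i j ik Mij.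
  apply/negP => /cj e; by rewrite -e ltnn in ik.
eexists; first exact: mu_similar_trans AM (mu_similar_pivot kj0 left0 above0).
move=> i l /ltS[->|ik].
  rewrite !mxE eqxx /=; case: (eqVneq l j) => [-> _|_]; last by rewrite divff // mul1r subrr eqxx.
  split=> [l'|i']; rewrite !mxE ?eqxx /=.
    by case: (eqVneq l' j) => // _; rewrite divff // mul1r subrr eqxx.
  by rewrite andbT; case: (eqVneq i' K0) => // _; rewrite divfK // subrr eqxx.
have iK : (i == K0) = false by apply/eqP => e; rewrite e ltnn in ik.
(* Earlier rows are unchanged, since column [j] vanishes there. *)
have rowi l' : M i l' - M i j / M K0 j * M K0 l' = M i l'.
  by rewrite above0 // !mul0r subr0.
rewrite !mxE iK /= rowi => Mil; have [rl cl] := hM i l ik Mil.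
have MKl : M K0 l = 0 by apply/eqP; apply: contraFT iK => /cl ->.
split=> [l'|i']; rewrite !mxE ?iK /= ?rowi; first exact: rl.
case: (eqVneq i' K0) => [->|_] /=; last by rewrite MKl mulr0 subr0; exact: cl.
by case: (eqVneq l j) => [lj|_]; [rewrite -lj MKl eqxx|rewrite MKl mulr0 subr0 eqxx].
Qed.

(** * Comparison of similar matrices of U_m *)

(* Within U_m, an entry lying under or to the right of another non-zero entry
   vanishes, so the off-diagonal part of C and D never contributes. *)
Lemma in_U_mutual_entry B B' C D :
    in_U B -> in_U B' -> mu_mutual C D -> C *m B = B' *m D ->
  forall i j, C i i * B i j = B' i j * C j j.
Proof.
move=> /in_UP[rB cB] /in_UP[rB' cB'] [uC uD tC tD CD] /matrixP eqBB' i j.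
have C0 i' := trig_unitmx_diag_neq0 i' tC uC.
(* Positions above or to the left of [(i, j)] have a smaller index sum, so there the supports of [B]
   and [B'] already agree. *)
have [n] := ubnP (i + j)%N; elim: n i j => // n IH i j; rewrite ltnS => lijn.
have supp (i' j' : 'I_m) : (i' + j' < i + j)%N -> (B i' j' != 0) = (B' i' j' != 0).
  move=> lt; have := IH i' j' (leq_trans lt lijn).
  by move/(congr1 (fun x => x != 0)) => /=; rewrite !mulf_eq0 !(negPf (C0 _)) orbF.
have [k /andP[ki Bkj]|colB0] := pickP [pred k : 'I_m | (k < i)%N && (B k j != 0)].
  have B'kj : B' k j != 0 by rewrite -supp // ltn_add2r.
  have -> : B i j = 0.
    by apply/eqP; apply: contraTT ki => /(cB _ _ _ Bkj) ->; rewrite ltnn.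
  have -> : B' i j = 0.
    by apply/eqP; apply: contraTT ki => /(cB' _ _ _ B'kj) ->; rewrite ltnn.
  by rewrite mulr0 mul0r.
have [l /andP[lj B'il]|rowB'0] := pickP [pred l : 'I_m | (l < j)%N && (B' i l != 0)].
  have Bil : B i l != 0 by rewrite supp // ltn_add2l.
  have -> : B i j = 0.
    by apply/eqP; apply: contraTT lj => /(rB _ _ _ Bil) ->; rewrite ltnn.
  have -> : B' i j = 0.
    by apply/eqP; apply: contraTT lj => /(rB' _ _ _ B'il) ->; rewrite ltnn.
  by rewrite mulr0 mul0r.
have := eqBB' i j; rewrite !mxE (bigD1 i) //= big1 ?addr0 => [->|k].
  rewrite (bigD1 j) //= big1 ?addr0 ?CD // => l.
  rewrite neq_ltn => /orP[lj|jl].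
    by have /= := rowB'0 l; rewrite lj => /negbFE/eqP->; rewrite mul0r.
  have /is_trig_mxP/(_ _ _ jl) := tD; by rewrite mxE => ->; rewrite mulr0.
rewrite neq_ltn => /orP[ki|ik].
  by have /= := colB0 k; rewrite ki => /negbFE/eqP->; rewrite mulr0.
by have /is_trig_mxP/(_ _ _ ik) -> := tC; rewrite mul0r.
Qed.

(** * Cycles and closed chains *)

(* Reading non-zero entries as arrows i -> j, a matrix of U_m is a union of
   disjoint paths and cycles; [connect (step_above W k) j k] says that the arrow
   k -> j lies on a cycle whose least vertex is k, i.e. leads a closed chain. *)
Definition step_above W (k : 'I_m) : rel 'I_m :=
  [rel x y : 'I_m | (k < x)%N && (W x y != 0)].

Lemma connect_ind (T : finType) (e : rel T) (P : T -> Prop) (x y : T) :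
  (forall u v, e u v -> P u -> P v) -> connect e x y -> P x -> P y.
Proof.
move=> step /connectP[p + ->]; elim: p x => //= z p IH x /andP[xz pz] Px.
exact/(IH z)/(step x).
Qed.

Lemma connect_step_l (T : finType) (e : rel T) (x y : T) :
  connect e x y -> x = y \/ exists2 z, e x z & connect e z y.
Proof.
case/connectP=> [[|z p] /= pth ->]; first by left.
by right; case/andP: pth => xz pz; exists z => //; apply/connectP; exists p.
Qed.

Lemma connect_step_r (T : finType) (e : rel T) (x y : T) :
  connect e x y -> x = y \/ exists2 z, connect e x z & e z y.
Proof.
move=> xy; pose P y := x = y \/ exists2 z, connect e x z & e z y.
apply: (connect_ind (P := P) _ xy); last by left.
rewrite {}/P {y xy}; move=> u v uv [xu|[z xz zu]]; right; exists u => //; first by rewrite xu.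
exact: connect_trans xz (connect1 zu).
Qed.

Lemma connect_step_above_ge {W} {k x : 'I_m} : connect (step_above W k) x k -> (k <= x)%N.
Proof. by case/connect_step_l => [->|[z /andP[/ltnW]]]. Qed.

(** Arrows out of a vertex are unique: a path from [x] to [k] is empty, so that [y = j], or starts
    with [x -> y]. *)
Lemma cycle_forward {W} {k j x y : 'I_m} : in_U W ->
    W k j != 0 -> connect (step_above W k) j k -> W x y != 0 ->
  connect (step_above W k) x k -> connect (step_above W k) y k.
Proof.
move=> /in_UP[r _] kj jk xy /connect_step_l[xk|[z /andP[_ xz]]].
  by rewrite xk in xy; rewrite (r _ _ _ xy kj).
by rewrite (r _ _ _ xy xz).
Qed.

Lemma cycle_backward {W} {k j x y : 'I_m} : in_U W ->
    W k j != 0 -> connect (step_above W k) j k -> W x y != 0 ->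
  connect (step_above W k) j y -> connect (step_above W k) j x.
Proof.
move=> /in_UP[_ c] kj jk xy /connect_step_r[jy|[z jz /andP[_ zy]]].
  by rewrite -jy in xy; rewrite (c _ _ _ xy kj).
by rewrite (c _ _ _ xy zy).
Qed.

Lemma cycle_ge {W} {k j y : 'I_m} : in_U W ->
    W k j != 0 -> connect (step_above W k) j k ->
  connect (step_above W k) j y -> (k <= y)%N.
Proof.
move=> uW kj jk jy; apply: (connect_step_above_ge (W := W)).
apply: (connect_ind (P := fun y => connect (step_above W k) y k) _ jy jk) => u v.
by case/andP=> _ uv; exact: cycle_forward uW kj jk uv.
Qed.

Lemma maximal_closed_chain W (p : 'I_m * 'I_m) s :
    in_U W -> connect (step_above W p.1) p.2 p.1 ->
  chain W (p :: s) -> closed_chain (p :: s) -> maximal_chain W (p :: s).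
Proof.
move=> uW pcyc cs /eqP clos; split=> // t ct /infixP[u [v tE]].
case/and3P: (cs) => /= /andP[Wp _] _ _.
case: u => [|q u] in tE.
  (* An arrow appended at the end would start at [p.1], but later arrows must start strictly above
     it. *)
  case: v => [|q v] in tE; first by rewrite tE /= cats0.
  move: ct; rewrite tE /= => /and3P[_]; rewrite cat_path all_cat /= => /and3P[_ /eqP-> _].
  by rewrite -clos ltnn andbF.
(* A longer chain to the left would start below [p.1]; yet walking back from [p] stays on the cycle,
   whose least vertex is [p.1]. *)
have : (q.1 < p.1)%N.
  by move: ct; rewrite tE /= => /and3P[_ _]; rewrite !all_cat /= => /and3P[_ ->].
suff /(cycle_ge uW Wp pcyc) : connect (step_above W p.1) p.2 q.1 by rewrite leqNgt => /negPf->.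
move: ct; rewrite tE /= => /and3P[/andP[Wq +] + _].
rewrite all_cat cat_path => /andP[au _] /andP[]; move: au.
elim: u q Wq {tE} => [|r u IH] q Wq /=.
  by move=> _ _ /andP[/eqP pq _]; apply: (cycle_backward uW Wp pcyc Wq); rewrite -pq.
case/andP=> Wr au /andP[/eqP rq pr] pth.
by apply: (cycle_backward uW Wp pcyc Wq); rewrite -rq; apply: IH.
Qed.

Lemma leads_closed_chainP W (k j : 'I_m) : in_U W -> W k j != 0 ->
  leads_closed_chain W (k, j) <-> connect (step_above W k) j k.
Proof.
move=> uW Wkj; split.
  move=> [s [[/and3P[/andP[_ nz] pth gt] _] /eqP /= clos]].
  suff h (p : 'I_m * 'I_m) : all (fun q : 'I_m * 'I_m => W q.1 q.2 != 0) s ->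
      all (fun q : 'I_m * 'I_m => (k < q.1)%N) s ->
      path (fun p1 p2 : 'I_m * 'I_m => p2.1 == p1.2) p s ->
      connect (step_above W k) p.2 (last p s).2.
    by rewrite {2}clos; exact: (h (k, j)).
  elim: s p {nz pth gt clos} => //= q s IH p.
  move=> /andP[Wq nz] /andP[kq gt] /andP[/eqP <- pth].
  by apply: connect_trans _ (IH q nz gt pth); apply: connect1; apply/andP.
move=> jk; suff [s cs clos] : exists2 s, chain W ((k, j) :: s) & closed_chain ((k, j) :: s).
  by exists s; split=> //; exact: maximal_closed_chain.
(* The preceding arrow matters only through its end point, so it is generalised for the induction on
   the path. *)
suff /(_ (k, j) erefl)[s nz [pth [gt clos]]] : forall q : 'I_m * 'I_m, q.2 = j ->
    exists2 s, all (fun r : 'I_m * 'I_m => W r.1 r.2 != 0) s &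
      path (fun p1 p2 : 'I_m * 'I_m => p2.1 == p1.2) q s /\
      all (fun r : 'I_m * 'I_m => (k < r.1)%N) s /\ (last q s).2 = k.
  by exists s; [apply/and3P; split=> //=; rewrite Wkj|rewrite /= clos].
case/connectP: jk => p pth {2}->.
elim: p j pth {Wkj} => [|z p IH] j /= pth q qj; first by exists [::].
case/andP: pth => /andP[kj Wjz] /IH/(_ (j, z) erefl)[s nz [sp [gt clos]]].
by exists ((j, z) :: s); rewrite /= ?Wjz ?kj ?nz ?sp ?qj ?eqxx.
Qed.

(** * Normalisation by diagonal scaling *)

(* Rows are treated in decreasing order: if k -> j does not close a cycle, the
   vertices reachable from j through rows > k can be rescaled without affecting
   the arrows already normalised. *)
Lemma exists_torus_scaling W : in_U W ->
  exists2 t : 'I_m -> K, (forall i, t i != 0) &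
    forall x y, W x y != 0 -> ~~ connect (step_above W x) y x ->
      t x * W x y = t y.
Proof.
move=> uW; have /in_UP[r c] := uW.
suff /(_ m)[t t0 ht] : forall n, exists2 t : 'I_m -> K, (forall i, t i != 0) &
    forall x y : 'I_m, (m - n <= x)%N -> W x y != 0 ->
      ~~ connect (step_above W x) y x -> t x * W x y = t y.
  by exists t => // x y; apply: ht; rewrite subnn.
elim=> [|n [t t0 IH]].
  exists (fun=> 1) => [i|x y]; first exact: oner_neq0.
  by rewrite subn0 leqNgt ltn_ord.
(* Once [m <= n], truncated subtraction gives 0 for both bounds and no new row appears. *)
have [mn|nm] := leqP m n.
  exists t => // x y _; apply: IH; move: mn; rewrite -subn_eq0 => /eqP->.
  exact: leq0n.
have km : (m - n.+1 < m)%N by rewrite ltn_subrL ltn0Sn (leq_ltn_trans _ nm).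
pose k := Ordinal km.
have kS (x : 'I_m) : (m - n.+1 <= x)%N -> x = k \/ (k < x)%N.
  by rewrite leq_eqVlt => /orP[/eqP kx|]; [left; exact: val_inj|right].
have {}IH (x y : 'I_m) : (k < x)%N -> W x y != 0 -> ~~ connect (step_above W x) y x ->
    t x * W x y = t y.
  by move=> kx; apply: IH; rewrite (leq_trans _ kx) // subnSK.
have [j /andP[Wkj kj]|noj] :=
    pickP [pred j | (W k j != 0) && ~~ connect (step_above W k) j k]; last first.
  exists t => // x y /kS[->|kx]; last exact: IH.
  by move=> Wxy nc; have := noj y; rewrite /= Wxy nc.
(* The factor for which [t k * W k j = s * t j]; [k] itself is not rescaled. *)
pose s := t k * W k j / t j.
have s0 : s != 0 by rewrite !mulf_neq0 ?invr_neq0.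
exists (fun i => if connect (step_above W k) j i then s * t i else t i).
  by move=> i; case: ifP => // _; rewrite mulf_neq0.
move=> x y /kS[-> Wky _|kx Wxy nc].
  rewrite -(r _ _ _ Wkj Wky) (negPf kj) connect0 /s divfK //.
(* Both ends of an arrow starting above [k] are rescaled together: its start is the only predecessor
   of [y], and [y = j] would force [x = k]. *)
have -> : connect (step_above W k) j y = connect (step_above W k) j x.
  apply/idP/idP => [/connect_step_r[jy|[z jz /andP[_ Wzy]]]|jx].
  - by move: kx; rewrite -jy in Wxy; rewrite (c _ _ _ Wxy Wkj) ltnn.
  - by rewrite (c _ _ _ Wxy Wzy).
  - by apply: connect_trans jx (connect1 _); apply/andP.
by case: ifP => _; rewrite -?mulrA IH.
Qed.

Lemma eq_step_above_connect W W' k :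
  (forall i j, (W i j != 0) = (W' i j != 0)) ->
  connect (step_above W k) =2 connect (step_above W' k).
Proof. by move=> eqW; apply: eq_connect => x y; rewrite /step_above /= eqW. Qed.

Lemma in_RP W : in_R W <-> in_U W /\
  forall i j, W i j != 0 -> ~~ connect (step_above W i) j i -> W i j = 1.
Proof.
split=> -[uW h]; split=> // i j Wij.
  by move=> /negP nc; apply: h => // /(leads_closed_chainP uW Wij).
by move=> nc; apply: h => //; apply/negP => /(leads_closed_chainP uW Wij).
Qed.

Lemma mu_similar_in_R A : exists2 B, mu_similar A B & in_R B.
Proof.
have [W AW uW] := mu_similar_in_U A; have [t t0 ht] := exists_torus_scaling uW.
pose B : 'M[K]_m := \matrix_(i, j) (t i * W i j / t j).
have suppB i j : (B i j != 0) = (W i j != 0).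
  by rewrite mxE !mulf_eq0 invr_eq0 !(negPf (t0 _)) orbF.
exists B.
  apply: mu_similar_trans AW _.
  exists (diag_mx (\row_i t i)), (diag_mx (\row_i t i)); split.
    have dt : is_trig_mx (diag_mx (\row_i t i)) by exact: diag_mx_is_trig.
    have ut : diag_mx (\row_i t i) \in unitmx.
      by rewrite unitmxE unitfE det_diag; apply/prodf_neq0 => i _; rewrite mxE.
    by split; rewrite // tr_diag_mx.
  apply/matrixP => i j; rewrite mul_diag_mx mul_mx_diag !mxE divfK //.
have uB : in_U B.
  move/in_UP: uW => [r c]; apply/in_UP; split=> i j k; rewrite !suppB; [exact: r|exact: c].
apply/in_RP; split=> // i j; rewrite suppB (eq_step_above_connect _ suppB) => Wij nc.
by rewrite mxE ht // divff.
Qed.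

(** * Uniqueness of the canonical form *)

(** Otherwise following the path from [y] to [k] would place [k] on a cycle with least vertex [x],
    against [k < x]. *)
Lemma cycle_not_leader W (k j x y : 'I_m) : in_U W ->
    W k j != 0 -> connect (step_above W k) j k ->
    (k < x)%N -> W x y != 0 -> connect (step_above W k) y k ->
  ~~ connect (step_above W x) y x.
Proof.
move=> uW Wkj jk kx Wxy yk; apply/negP => yx.
suff /connect_step_above_ge : connect (step_above W x) k x by rewrite leqNgt kx.
apply: (connect_ind (P := fun z => connect (step_above W x) z x) _ yk) => // u v.
by case/andP=> _ uv; exact: cycle_forward uW Wxy yx uv.
Qed.

Lemma in_R_mu_similar_eq B B' : in_R B -> in_R B' -> mu_similar B B' -> B = B'.
Proof.
move=> /in_RP[uB RB] /in_RP[uB' RB'] [C [D [CD eqBB']]].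
have ent := in_U_mutual_entry uB uB' CD eqBB'.
have [uC _ tC _ _] := CD.
have C0 i := trig_unitmx_diag_neq0 i tC uC.
have supp i j : (B i j != 0) = (B' i j != 0).
  have /(congr1 (fun x => x != 0)) /= := ent i j.
  by rewrite !mulf_eq0 !(negPf (C0 _)) orbF.
have one i j : B i j != 0 -> ~~ connect (step_above B i) j i -> B i j = 1 /\ B' i j = 1.
  move=> Bij nc; split; first exact: RB.
  by apply: RB'; rewrite -?supp // -(eq_step_above_connect _ supp).
apply/matrixP => i j; have [Bij|Bij] := eqVneq (B i j) 0.
  by rewrite Bij; apply/esym/eqP/negbFE; rewrite -supp Bij eqxx.
have [ji|nc] := boolP (connect (step_above B i) j i); last first.
  by have [-> ->] := one i j Bij nc.
suff eqC : C j j = C i i.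
  by apply: (mulfI (C0 i)); rewrite ent eqC mulrC.
suff [] : C j j = C i i /\ connect (step_above B i) i i by [].
(* The second component keeps the walk on the cycle, where every arrow starting above [i] has weight
   1 in both matrices and so preserves the diagonal entry of [C]. *)
pose P z := C j j = C z z /\ connect (step_above B i) z i.
apply: (connect_ind (P := P) _ ji) => // u v /andP[iu Buv] [ju ui].
have vi := cycle_forward uB Bij ji Buv ui; split=> //; rewrite ju.
have [Buv1 B'uv1] := one u v Buv (cycle_not_leader uB Bij ji iu Buv vi).
by have := ent u v; rewrite Buv1 B'uv1 mulr1 mul1r.
Qed.

End MuSimilarity.

Theorem theorem3p1 (K : closedFieldType) (charK0 : [pchar K] =i pred0)
    (m : nat) (m_gt0 : (0 < m)%N) (A : 'M[K]_m) :
  exists! B : 'M[K]_m, in_R B /\ mu_similar A B.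
Proof.
have [B AB RB] := mu_similar_in_R A; exists B; split=> // B' [RB' AB'].
by apply: in_R_mu_similar_eq => //; apply: mu_similar_trans (mu_similar_sym AB) AB'.
Qed.
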